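(* Let $\mathbf{k}$ be a field, let $X=\{x_1,\dots,x_n\}$ be a set with $n\ge 2$ elements, let $f\in\mathrm{Sym}(X)$, and let $(X,r_f)$ be the permutation idempotent solution $r_f(x,y)=(f(y),y)$. Its Yang-Baxter algebra is $\mathcal{A}=\mathcal{A}(\mathbf{k},X,r_f)=\mathbf{k}\langle X\rangle/(\Re_0)$ with $\Re_0=\{x_jx_p-f(x_p)x_p\mid 1\le j,p\le n\}$. Then: (1) $\mathcal{A}$ is a PBW algebra with the standard finite presentation $$\mathcal{A}=\mathbf{k}\langle X\rangle/(\Re),\qquad \Re=\{x_jx_p-x_1x_p\mid 2\le j\le n,\ 1\le p\le n\},$$ where $\Re$ consists of $n(n-1)$ quadratic binomials and is the reduced Gröbner basis (with respect to the degree-lexicographic order) of the two-sided ideal $I=(\Re)=(\Re_0)$ of $\mathbf{k}\langle X\rangle$. (2) The set of normal monomials modulo $I$, $$\mathcal{N}=\{1\}\cup\{x_1^{\alpha}x_m\mid \alpha\in\mathbb{N}_0,\ m\in\{1,\dots,n\}\},$$ is a PBW $\mathbf{k}$-basis of $\mathcal{A}$. In particular $\mathcal{A}$ is a graded algebra of Gelfand-Kirillov dimension $1$, isomorphic as a graded algebra to $(\mathbf{k}\mathcal{N},\bullet)$, with $\mathcal{A}=\bigoplus_{d\ge0}\mathcal{A}_d\cong\bigoplus_{d\ge 0}\mathbf{k}\mathcal{N}_d$, where for each $d\ge1$ the component $\mathcal{A}_d$ has as $\mathbf{k}$-basis the set of normal monomials of length $d$, $$\mathcal{N}_d=\{w_1=x_1^d<w_2=x_1^{d-1}x_2<\cdots<w_n=x_1^{d-1}x_n\}.$$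 (3) The Hilbert function and Hilbert series of $\mathcal{A}$ are $$h_{\mathcal{A}}(d)=\dim\mathcal{A}_d=n\ \ \text{for all } d\ge1,\qquad H_{\mathcal{A}}(t)=1+nt+nt^2+nt^3+\cdots=\frac{1+(n-1)t}{1-t}.$$
   Context: $\langle X\rangle$ is the free monoid on $X$, $\mathbf{k}\langle X\rangle$ the free unital associative algebra, graded by word length; $(F)$ denotes the two-sided ideal generated by $F$. $<$ is the degree-lexicographic order on $\langle X\rangle$ with $x_1<\dots<x_n$; the leading monomial of a nonzero polynomial is its largest monomial. A set $G$ of monic polynomials in an ideal $I$ is a Gröbner basis of $I$ if it generates $I$ and the leading monomial of every nonzero element of $I$ contains the leading monomial of some $g\in G$ as a subword; it is reduced if no proper subset $G\setminus\{g\}$ is a Gröbner basis of $I$ and each $g\in G$ is a linear combination of monomials containing no leading monomial of an element of $G\setminus\{g\}$ as a subword. A monomial is normal modulo $I$ if it contains no leading monomial of an element of $I$ as a subword; each $u\in\mathbf{k}\langle X\rangle$ is uniquely $u=h+\mathrm{Nor}(u)$ with $h\in I$ and $\mathrm{Nor}(u)$ in the span $\mathbf{k}\mathcal{N}$ of the normal monomials; the product on $\mathbf{k}\mathcal{N}$ is $a\bullet b=\mathrm{Nor}(ab)$. A quadratic algebra $\mathbf{k}\langle X\rangle/I$ is PBW (with PBW-generators $x_1,\dots,x_n$ in this order) if $I$ has a Gröbner basis consisting of homogeneous quadratic polynomials; the set of normal monomials is then called its PBW basis. *)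

(* Defs.v *)
From HB Require Import structures.
From mathcomp Require Import all_boot all_order all_algebra fingroup perm.
From mathcomp Require Import generic_quotient ring_quotient.
(* The notations of monalg clash with those of MathComp-Analysis. *)
From mathcomp Require Import -(notations) monalg.
From mathcomp Require Import finmap boolp classical_sets cardinality.
From mathcomp Require Import reals ereal sequences exp.

Set Implicit Arguments.
Unset Strict Implicit.
Unset Printing Implicit Defensive.

Import Order.TTheory GRing.Theory Num.Theory.
Local Open Scope classical_set_scope.
Local Open Scope ring_scope.

Section Linear.
Variables (k : fieldType) (V : lmodType k).

Definition subspace (W : set V) : Prop :=
  W 0 /\ forall (c : k) u v, W u -> W v -> W (c *: u + v).

Definition lin_span (T : eqType) (D : set T) (v : T -> V) : set V :=
  [set u | exists (s : seq T) (c : T -> k),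
     (forall i, i \in s -> D i) /\ u = \sum_(i <- s) c i *: v i].

(* Families are indexed, so a basis family is in particular injective on D. *)
Definition free_family (T : eqType) (D : set T) (v : T -> V) : Prop :=
  forall (s : seq T) (c : T -> k),
    uniq s -> (forall i, i \in s -> D i) ->
    \sum_(i <- s) c i *: v i = 0 -> forall i, i \in s -> c i = 0.

Definition basis_family (T : eqType) (D : set T) (v : T -> V) (W : set V) :
    Prop :=
  free_family D v /\ lin_span D v = W.

(* The dimension of a finite-dimensional subspace; the default value 0 is taken
   on the sets which are not finite-dimensional subspaces. *)
Definition dimension (W : set V) : nat :=
  xget 0%N [set d | exists v : 'I_d -> V, basis_family setT v W].

Definition direct_sum (W : set V) (G : nat -> set V) : Prop :=
  [/\ forall d, subspace (G d),
      forall u, W u <-> exists (m : nat) (c : nat -> V),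
        (forall d, G d (c d)) /\ u = \sum_(d < m) c d
    & forall (m : nat) (c : nat -> V), (forall d, G d (c d)) ->
        \sum_(d < m) c d = 0 -> forall d, (d < m)%N -> c d = 0].

End Linear.

Section Graded.
Variables (k : fieldType) (A : algType k).

Definition graded_algebra (G : nat -> set A) : Prop :=
  [/\ direct_sum setT G, G 0%N 1
    & forall i j a b, G i a -> G j b -> G (i + j)%N (a * b)].

Definition hilbert_function (G : nat -> set A) (d : nat) : nat :=
  dimension (G d).

(* Formal power series over the integers are coefficient sequences. *)
Definition hilbert_series (G : nat -> set A) : nat -> int :=
  fun d => (hilbert_function G d)%:Z.

(* An isomorphism of graded algebras from A onto the subspace W of V, where W
   carries the product mulW, the unit oneW and the homogeneous components WG. *)
Definition graded_iso_onto (G : nat -> set A) (V : lmodType k) (W : set V)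
    (oneW : V) (mulW : V -> V -> V) (WG : nat -> set V)
    (phi : {linear A -> V}) : Prop :=
  [/\ injective phi, phi @` setT = W, phi 1 = oneW,
      forall a b, phi (a * b) = mulW (phi a) (phi b)
    & forall d, phi @` G d = WG d].

(* V^0 + V^1 + ... + V^d for the subspace V spanned by s. *)
Definition power_span (s : seq A) (d : nat) : set A :=
  lin_span [set w : seq A | {subset w <= s} /\ (size w <= d)%N]
       (fun w => \prod_(a <- w) a).

(* The supremum, over the finite-dimensional subspaces V of A, of
   limsup_d (log dim (V^0 + ... + V^d) / log d). *)
Definition gk_dim (R : realType) : \bar R :=
  ereal_sup (range (fun s : seq A =>
    limn_esup (fun d =>
      (ln (dimension (power_span s d))%:R / ln d%:R : R)%:E))).

End Graded.

(* H = P / Q in the ring of formal power series over the integers. *)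
Definition series_eq_frac (H : nat -> int) (P Q : {poly int}) : Prop :=
  Q`_0 \is a GRing.unit /\
  forall d, \sum_(i < d.+1) H i * Q`_(d - i) = P`_d.

Section Ideals.
Variable R : nzRingType.

Definition two_sided_ideal (J : set R) : Prop :=
  [/\ J 0, forall u v, J u -> J v -> J (u + v),
      forall a u, J u -> J (a * u) & forall a u, J u -> J (u * a)].

Definition ideal_gen (F : set R) : set R := smallest two_sided_ideal F.

Lemma ideal_gen_ideal F : two_sided_ideal (ideal_gen F).
Proof.
split=> [J [[]]//|u v Iu Iv J JF|a u Iu J JF|a u Iu J JF];
  have [[_ JD JL JR] _] := JF.
- by apply: JD; [exact: Iu|exact: Iv].
- by apply: JL; exact: Iu.
- by apply: JR; exact: Iu.
Qed.

(* Properness is required because MathComp algebras are nontrivial. *)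
Record proper_ideal := ProperIdeal {
  ideal_set : set R;
  ideal_setP : two_sided_ideal ideal_set;
  ideal_set1 : ~ ideal_set 1
}.

Definition ideal_pred (I : proper_ideal) : {pred R} := fun u => `[< ideal_set I u >].

Fact ideal_pred_zmod (I : proper_ideal) : zmod_closed (ideal_pred I).
Proof.
have [I0 ID IL IR] := ideal_setP I.
split=> [|u v]; rewrite !unfold_in; first exact/asboolP.
move=> /asboolP Iu /asboolP Iv; apply/asboolP.
by rewrite -mulN1r; apply: ID => //; apply: IL.
Qed.

HB.instance Definition _ (I : proper_ideal) :=
  GRing.isZmodClosed.Build R (ideal_pred I) (ideal_pred_zmod I).

End Ideals.

(* ring_quotient only endows quotients of commutative rings with a product. *)
Section QuotientAlgebra.
Variables (k : fieldType) (A : algType k) (I : proper_ideal A).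
Local Open Scope quotient_scope.

Definition quot_alg : Type := Quotient.quot (ideal_pred I).
HB.instance Definition _ := GRing.Zmodule.on quot_alg.

Definition quot_proj (u : A) : quot_alg := \pi_(Quotient.quot (ideal_pred I)) u.

Definition quot_lift (a : quot_alg) : A := repr a.

Definition quot_one : quot_alg := quot_proj 1.
Definition quot_mul (a b : quot_alg) : quot_alg :=
  quot_proj (quot_lift a * quot_lift b).
Definition quot_scale (c : k) (a : quot_alg) : quot_alg :=
  quot_proj (c *: quot_lift a).

Lemma quot_liftK : cancel quot_lift quot_proj.
Proof. by move=> a; exact: reprK. Qed.

Lemma quot_projE u v : quot_proj u = quot_proj v <-> ideal_set I (u - v).
Proof.
have := Quotient.idealrBE (ideal_pred I) u v; rewrite unfold_in => E.
split=> [uv|uv]; first by apply/asboolP; rewrite /ideal_pred E; apply/eqP.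
by apply/eqP; rewrite /quot_proj -E; apply/asboolP.
Qed.

Lemma quot_lift_proj u : ideal_set I (quot_lift (quot_proj u) - u).
Proof. by apply/quot_projE; rewrite quot_liftK. Qed.

Lemma quot_projB : {morph quot_proj : u v / u - v}.
Proof. by move=> u v; exact: (raddfB \pi_(Quotient.quot (ideal_pred I))). Qed.

Lemma quot_projD : {morph quot_proj : u v / u + v}.
Proof. by move=> u v; exact: (raddfD \pi_(Quotient.quot (ideal_pred I))). Qed.

Lemma quot_projM u v : quot_proj (u * v) = quot_mul (quot_proj u) (quot_proj v).
Proof.
have [I0 ID IL IR] := ideal_setP I.
apply/esym/quot_projE; set u' := quot_lift _; set v' := quot_lift _.
have -> : u' * v' - u * v = (u' - u) * v' + u * (v' - v).
  by rewrite mulrBl mulrBr addrA subrK.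
by apply: ID; [apply: IR|apply: IL]; exact: quot_lift_proj.
Qed.

Lemma quot_projZ c u : quot_proj (c *: u) = quot_scale c (quot_proj u).
Proof.
have [I0 ID IL IR] := ideal_setP I.
apply/esym/quot_projE; rewrite -scalerBr -[_ - u]mul1r scalerAl.
by apply: IL; exact: quot_lift_proj.
Qed.

Fact quot_mulA : associative quot_mul.
Proof.
move=> a b c; rewrite -(quot_liftK a) -(quot_liftK b) -(quot_liftK c).
by rewrite -!quot_projM mulrA.
Qed.

Fact quot_mul1 : left_id quot_one quot_mul.
Proof. by move=> a; rewrite -(quot_liftK a) -quot_projM mul1r. Qed.

Fact quot_1mul : right_id quot_one quot_mul.
Proof. by move=> a; rewrite -(quot_liftK a) -quot_projM mulr1. Qed.

Fact quot_mulDl : left_distributive quot_mul +%R.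
Proof.
move=> a b c; rewrite -(quot_liftK a) -(quot_liftK b) -(quot_liftK c).
by rewrite -quot_projD -!quot_projM mulrDl quot_projD.
Qed.

Fact quot_mulDr : right_distributive quot_mul +%R.
Proof.
move=> a b c; rewrite -(quot_liftK a) -(quot_liftK b) -(quot_liftK c).
by rewrite -quot_projD -!quot_projM mulrDr quot_projD.
Qed.

Fact quot_one_neq0 : quot_one != 0.
Proof.
apply/eqP => one0; apply: (@ideal_set1 _ I); rewrite -[1]subr0.
apply/quot_projE; rewrite -[LHS]/quot_one one0; apply/esym.
exact: (raddf0 \pi_(Quotient.quot (ideal_pred I))).
Qed.

HB.instance Definition _ := GRing.Zmodule_isNzRing.Build quot_alg
  quot_mulA quot_mul1 quot_1mul quot_mulDl quot_mulDr quot_one_neq0.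

Fact quot_scaleA (c d : k) (a : quot_alg) :
  quot_scale c (quot_scale d a) = quot_scale (c * d) a.
Proof. by rewrite -(quot_liftK a) -!quot_projZ scalerA. Qed.

Fact quot_scale1 : left_id 1 quot_scale.
Proof. by move=> a; rewrite -(quot_liftK a) -!quot_projZ scale1r. Qed.

Fact quot_scaleDr : right_distributive quot_scale +%R.
Proof.
move=> c a b; rewrite -(quot_liftK a) -(quot_liftK b).
by rewrite -quot_projD -!quot_projZ scalerDr quot_projD.
Qed.

Fact quot_scaleDl (a : quot_alg) :
  {morph quot_scale^~ a : c d / c + d}.
Proof.
move=> c d; rewrite -(quot_liftK a).
by rewrite -!quot_projZ scalerDl quot_projD.
Qed.

HB.instance Definition _ := GRing.Zmodule_isLmodule.Build k quot_alg
  quot_scaleA quot_scale1 quot_scaleDr quot_scaleDl.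

Fact quot_scaleAl (c : k) (a b : quot_alg) : c *: (a * b) = (c *: a) * b.
Proof.
rewrite -(quot_liftK a) -(quot_liftK b).
change (quot_scale c (quot_mul (quot_proj (quot_lift a))
                               (quot_proj (quot_lift b)))
  = quot_mul (quot_scale c (quot_proj (quot_lift a)))
             (quot_proj (quot_lift b))).
by rewrite -quot_projM -!quot_projZ -quot_projM scalerAl.
Qed.

HB.instance Definition _ :=
  GRing.Lmodule_isLalgebra.Build k quot_alg quot_scaleAl.

Fact quot_scaleAr (c : k) (a b : quot_alg) : c *: (a * b) = a * (c *: b).
Proof.
rewrite -(quot_liftK a) -(quot_liftK b).
change (quot_scale c (quot_mul (quot_proj (quot_lift a))
                               (quot_proj (quot_lift b)))
  = quot_mul (quot_proj (quot_lift a))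
             (quot_scale c (quot_proj (quot_lift b)))).
by rewrite -quot_projM -!quot_projZ -quot_projM scalerAr.
Qed.

HB.instance Definition _ :=
  GRing.Lalgebra_isAlgebra.Build k quot_alg quot_scaleAr.

Fact quot_proj_zmod : zmod_morphism quot_proj.
Proof. exact: quot_projB. Qed.

HB.instance Definition _ :=
  GRing.isZmodMorphism.Build A quot_alg quot_proj quot_proj_zmod.

Fact quot_proj_monoid : monoid_morphism quot_proj.
Proof. by split=> // u v; exact: quot_projM. Qed.

HB.instance Definition _ :=
  GRing.isMonoidMorphism.Build A quot_alg quot_proj quot_proj_monoid.

Fact quot_proj_scalable : scalable quot_proj.
Proof. by move=> c u; exact: quot_projZ. Qed.

HB.instance Definition _ :=
  GRing.isScalable.Build k A quot_alg *:%R quot_proj quot_proj_scalable.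

End QuotientAlgebra.

(* The letters x_1 < ... < x_n are the elements of 'I_n in their usual order.
   Products and monomials of monalg are very slow to unify: they are locked. *)
HB.lock Definition freealg_mul (k : fieldType) (n : nat)
  (u v : malg (fmonom 'I_n) k) : malg (fmonom 'I_n) k := u * v.

HB.lock Definition freealg_scale (k : fieldType) (n : nat) (c : k)
  (u : malg (fmonom 'I_n) k) : malg (fmonom 'I_n) k := c *: u.

HB.lock Definition freealg_mono (k : fieldType) (n : nat) (w : fmonom 'I_n) :
  malg (fmonom 'I_n) k := mkmalgU w 1.

Section FreeAlgebra.
Variables (k : fieldType) (n : nat).

Local Notation fmul := (@freealg_mul k n).
Local Notation fscale := (@freealg_scale k n).

Definition freealg : Type := malg (fmonom 'I_n) k.
HB.instance Definition _ := GRing.Zmodule.on freealg.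

Fact freealg_mulA : associative fmul.
Proof. by rewrite freealg_mul.unlock; exact: mulrA. Qed.

Fact freealg_mul1 : left_id 1 fmul.
Proof. by rewrite freealg_mul.unlock; exact: mul1r. Qed.

Fact freealg_1mul : right_id 1 fmul.
Proof. by rewrite freealg_mul.unlock; exact: mulr1. Qed.

Fact freealg_mulDl : left_distributive fmul +%R.
Proof. by rewrite freealg_mul.unlock; exact: mulrDl. Qed.

Fact freealg_mulDr : right_distributive fmul +%R.
Proof. by rewrite freealg_mul.unlock; exact: mulrDr. Qed.

Fact freealg_one_neq0 : (1 : malg (fmonom 'I_n) k) != 0.
Proof. exact: oner_neq0. Qed.

HB.instance Definition _ := GRing.Zmodule_isNzRing.Build freealg
  freealg_mulA freealg_mul1 freealg_1mul freealg_mulDl freealg_mulDr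
  freealg_one_neq0.

Fact freealg_scaleA (c d : k) (u : freealg) :
  fscale c (fscale d u) = fscale (c * d) u.
Proof. by rewrite freealg_scale.unlock; exact: scalerA. Qed.

Fact freealg_scale1 : left_id 1 fscale.
Proof. by rewrite freealg_scale.unlock; exact: scale1r. Qed.

Fact freealg_scaleDr : right_distributive fscale +%R.
Proof. by rewrite freealg_scale.unlock; exact: scalerDr. Qed.

Fact freealg_scaleDl (u : freealg) : {morph fscale^~ u : c d / c + d}.
Proof. by rewrite freealg_scale.unlock; move=> c d; exact: scalerDl. Qed.

HB.instance Definition _ := GRing.Zmodule_isLmodule.Build k freealg
  freealg_scaleA freealg_scale1 freealg_scaleDr freealg_scaleDl.

Fact freealg_scaleAl (c : k) (u v : freealg) :
  fscale c (fmul u v) = fmul (fscale c u) v.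
Proof.
by rewrite freealg_scale.unlock freealg_mul.unlock; exact: scalerAl.
Qed.

HB.instance Definition _ :=
  GRing.Lmodule_isLalgebra.Build k freealg freealg_scaleAl.

Fact freealg_scaleAr (c : k) (u v : freealg) :
  fscale c (fmul u v) = fmul u (fscale c v).
Proof.
rewrite freealg_scale.unlock freealg_mul.unlock; apply/malgP => w.
rewrite mcoeffZ (mcoeffMl u v).
rewrite (mcoeffMlw _ (fsubset_refl _) (msuppZ_le c v)) mulr_sumr.
apply: eq_bigr => w1 _; rewrite mulr_sumr; apply: eq_bigr => w2 _.
by rewrite mcoeffZ mulrnAr mulrCA.
Qed.

HB.instance Definition _ :=
  GRing.Lalgebra_isAlgebra.Build k freealg freealg_scaleAr.

Lemma freealg_mulE (u v : freealg) : u * v = fmul u v. Proof. by []. Qed.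

Lemma freealg_scaleE (c : k) (u : freealg) : c *: u = fscale c u.
Proof. by []. Qed.

Definition mono (w : fmonom 'I_n) : freealg := freealg_mono k w.

End FreeAlgebra.

Arguments mono k {n} w.

Section Groebner.
Variables (k : fieldType) (n : nat).
Local Notation word := (fmonom 'I_n).
Local Notation freealg := (freealg k n).
Local Notation mono := (mono k).

Definition gen (i : 'I_n) : freealg := mono (FMonom [:: i]).

Definition deglex (u v : word) : bool :=
  (size u < size v)%N ||
  ((size u == size v) && (((u : seq 'I_n) : seqlexi 'I_n) < (v : seq 'I_n))%O).

Definition lead_mono (u : freealg) (w : word) : Prop :=
  w \in msupp u /\ forall v : word, v \in msupp u -> v != w -> deglex v w.

Definition is_monic (u : freealg) : Prop :=
  exists2 w, lead_mono u w & mcoeff w u = 1.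

Definition lead_monos (F : set freealg) : set word :=
  [set w | exists2 u, F u & lead_mono u w].

Definition groebner_basis (I G : set freealg) : Prop :=
  [/\ forall g, G g -> is_monic g, ideal_gen G = I
    & forall w, lead_monos I w ->
        exists2 v : word, lead_monos G v & infix v w].

Definition reduced_groebner_basis (I G : set freealg) : Prop :=
  [/\ groebner_basis I G,
      forall g, G g -> ~ groebner_basis I (G `\ g)
    & forall g, G g -> forall w : word, w \in msupp g ->
        forall v : word, lead_monos (G `\ g) v -> ~~ infix v w].

Definition normal_words (I : set freealg) : set word :=
  [set w | forall v : word, lead_monos I v -> ~~ infix v w].

Definition normal_words_deg (I : set freealg) (d : nat) : set word :=
  [set w | normal_words I w /\ size w = d].

Definition normal_span (I : set freealg) : set freealg :=
  lin_span (normal_words I) mono.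

Definition normal_span_deg (I : set freealg) (d : nat) : set freealg :=
  lin_span (normal_words_deg I d) mono.

(* Choice of the unique normal v with u - v in I. *)
Definition Nor (I : set freealg) (u : freealg) : freealg :=
  xget 0 [set v | normal_span I v /\ I (u - v)].

Definition normal_mul (I : set freealg) (u v : freealg) : freealg :=
  Nor I (u * v).

Definition homogeneous (d : nat) : set freealg :=
  [set u | forall w : word, w \in msupp u -> size w = d].

Definition is_binomial (u : freealg) : Prop :=
  exists v w : word, v <> w /\ forall x : word, x \in msupp u <-> x = v \/ x = w.

Definition quadratic_ideal (I : set freealg) : Prop :=
  exists2 F : set freealg, F `<=` homogeneous 2 & ideal_gen F = I.

(* The quadratic algebra freealg / I is PBW with PBW-generators x_1, ..., x_n. *)
Definition PBW (I : set freealg) : Prop :=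
  quadratic_ideal I /\
  exists2 G : set freealg, G `<=` homogeneous 2 & groebner_basis I G.

Definition quot_component (I : proper_ideal freealg) (d : nat) :
    set (quot_alg I) :=
  @quot_proj k freealg I @` homogeneous d.

Definition yb_relations (r : 'I_n * 'I_n -> 'I_n * 'I_n) : set freealg :=
  [set g | exists x y : 'I_n,
     g = gen x * gen y - gen (r (x, y)).1 * gen (r (x, y)).2].

Lemma yb_ideal_proper r : ~ ideal_gen (yb_relations r) 1.
Proof.
pose e : freealg -> k := mcoeff (@monalg.one (fmonom 'I_n)).
have e0 : e 0 = 0 by exact: mcoeff0.
have eB u v : e (u - v) = e u - e v by exact: mcoeffB.
have eD u v : e (u + v) = e u + e v by exact: mcoeffD.
have egen i : e (gen i) = 0.
  rewrite /e /gen /mono freealg_mono.unlock mcoeffU; case: eqP => // /(congr1 (@fmonom_val _)).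
  by rewrite fm1.
have eM u v : e (u * v) = e u * e v.
  by rewrite freealg_mulE freealg_mul.unlock; exact: (rmorphM (mcoeff _)).
have e1 : e 1 = 1 by exact: (rmorph1 (mcoeff _)).
clearbody e; move=> I1; suff /(I1 _) : [set M | two_sided_ideal M /\ yb_relations r `<=` M]
    [set u | e u = 0] by rewrite /= e1; apply/eqP/oner_neq0.
split.
- split; first exact: e0.
  + by move=> u v /= u0 v0; rewrite eD u0 v0 addr0.
  + by move=> a u /= u0; rewrite eM u0 mulr0.
  + by move=> a u /= u0; rewrite eM u0 mul0r.
- move=> _ [x [y ->]].
  by rewrite /mkset eB !eM !egen !mul0r subr0.
Qed.

Definition yb_ideal (r : 'I_n * 'I_n -> 'I_n * 'I_n) : proper_ideal freealg :=
  ProperIdeal (ideal_gen_ideal (yb_relations r)) (@yb_ideal_proper r).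

Definition yb_algebra (r : 'I_n * 'I_n -> 'I_n * 'I_n) : algType k :=
  quot_alg (yb_ideal r).

(* The word x_i^a x_m. *)
Definition pow_word (i : 'I_n) (a : nat) (m : 'I_n) : word :=
  FMonom (rcons (nseq a i) m).

Definition standard_relations (i : 'I_n) : set freealg :=
  [set g | exists j p : 'I_n,
     j <> i /\ g = gen j * gen p - gen i * gen p].

End Groebner.

Arguments gen k {n} i.
Arguments lead_mono {k n} u w.
Arguments is_monic {k n} u.
Arguments lead_monos {k n} F w.
Arguments groebner_basis {k n} I G.
Arguments reduced_groebner_basis {k n} I G.
Arguments normal_words {k n} I w.
Arguments normal_words_deg {k n} I d w.
Arguments normal_span {k n} I u.
Arguments normal_span_deg {k n} I d u.
Arguments Nor {k n} I u.
Arguments normal_mul {k n} I u v.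
Arguments homogeneous {k n} d u.
Arguments is_binomial {k n} u.
Arguments quadratic_ideal {k n} I.
Arguments PBW {k n} I.
Arguments quot_component {k n} I d u.
Arguments yb_relations k {n} r u.
Arguments yb_ideal k {n} r.
Arguments yb_algebra k {n} r.
Arguments standard_relations k {n} i u.

Section YangBaxter.
Variable X : Type.
Implicit Types (r : X * X -> X * X) (t : X * X * X).

Definition r12 r t : X * X * X := (r t.1, t.2).

Definition r23 r t : X * X * X :=
  let u := r (t.1.2, t.2) in (t.1.1, u.1, u.2).

Definition yb_solution r : Prop :=
  forall t, r12 r (r23 r (r12 r t)) = r23 r (r12 r (r23 r t)).

Definition idempotent_solution r : Prop :=
  yb_solution r /\ forall x, r (r x) = r x.

End YangBaxter.

Definition perm_solution (n : nat) (f : {perm 'I_n}) (t : 'I_n * 'I_n) :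
  'I_n * 'I_n := (f t.2, t.2).

Lemma perm_solutionP (n : nat) (f : {perm 'I_n}) :
  idempotent_solution (perm_solution f).
Proof. by split; case=> [[]]. Qed.

(* Main.v *)
Require Import Defs.
From HB Require Import structures.
From mathcomp Require Import all_boot all_order all_algebra fingroup perm.
From mathcomp Require Import -(notations) monalg.
From mathcomp Require Import finmap boolp classical_sets cardinality.
From mathcomp Require Import reals ereal sequences exp.

Set Implicit Arguments.
Unset Strict Implicit.
Unset Printing Implicit Defensive.

Import Order.TTheory GRing.Theory Num.Theory.
Local Open Scope classical_set_scope.
Local Open Scope ring_scope.

(** Every defining relation x_j x_p = f(x_p) x_p says that the first letter of
    a word of length 2 does not matter. So in the algebra a nonempty word
    depends only on its length d and on its last letter x_m, and it equals
    x_1^(d-1) x_m. Conversely, these words are not identified any further,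
    because the map [collapse] sending a word to x_1^(d-1) x_m only sees the
    length and the last letter, and both are respected by the relations.

    To make this precise, let [red] be the linear extension of [collapse] to
    the free algebra. Collapsing a factor of a word does not change the
    collapse of the word, so [red_ker], the kernel of [red], is a two-sided
    ideal. It contains the relations, and any ideal containing all x_j x_p -
    x_1 x_p contains u - red u for every u ([ideal_red]). Hence the ideals
    generated by the Yang-Baxter relations and by the standard relations both
    coincide with [red_ker] ([ideal_yb], [ideal_standard]).

    Since x_1 is the smallest letter, collapse w is the smallest word in the
    class of w. So the leading monomials of the ideal are exactly the words
    that are moved by [collapse] ([lead_monos_red_ker]), that is, the words in
    which a letter different from x_1 is followed by another letter
    ([collapse_infix]). Such a pair of letters is the leading monomial x_j x_p
    of a standard relation, whence the Groebner basis; it is reduced because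
    all leading monomials have length 2 and are distinct ([standard_reduced]).

    The normal words are therefore the fixed points of [collapse], and [red]
    computes the normal form. It induces a linear map [quot_red] from the
    quotient to the free algebra, which is an isomorphism of graded algebras
    onto the normal span ([quot_red_iso]); bases, grading and Hilbert function
    are read off from the list of normal words of each length.

    For the Gelfand-Kirillov dimension, the powers of a finite-dimensional
    subspace sit in the span of linearly many normal words
    ([dimension_power_span_leq]), and the powers of x_1 already give a linear
    lower bound ([dimension_power_span_gen]); linear growth has logarithmic
    exponent 1 ([log_growth_le1], [log_growth_ge1]). *)

(** * Spans and dimensions *)

Section Dimension.
Variables (k : fieldType) (V : lmodType k).

Lemma lin_span_sub (T : eqType) (D : set T) (v : T -> V) (W : set V) :
  Defs.subspace W -> (forall i, D i -> W (v i)) -> lin_span D v `<=` W.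
Proof.
move=> [W0 WZD] Wv _ [s [c [sD ->]]].
elim: s sD => [|i s IHs] sD; first by rewrite big_nil.
rewrite big_cons; apply: WZD; first by apply/Wv/sD/mem_head.
by apply: IHs => j js; apply: sD; rewrite inE js orbT.
Qed.

Lemma mem_lin_span (T : eqType) (D : set T) (v : T -> V) i :
  D i -> lin_span D v (v i).
Proof.
move=> Di; exists [:: i], (fun=> 1); rewrite big_seq1 scale1r.
by split=> // j; rewrite inE => /eqP->.
Qed.

Lemma subspace_combinations (T : eqType) (s : seq T) (v : T -> V) :
  Defs.subspace [set u | exists c : T -> k, u = \sum_(i <- s) c i *: v i].
Proof.
split=> [|a _ _ [c ->] [d ->]].
  by exists (fun=> 0); rewrite big1// => j _; rewrite scale0r.
exists (fun i => a * c i + d i); rewrite scaler_sumr -big_split.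
by apply: eq_bigr => j _; rewrite scalerA scalerDl.
Qed.

Lemma lin_span_uniq (T : eqType) (s : seq T) (v : T -> V) :
  uniq s ->
  lin_span [set` s] v = [set u | exists c, u = \sum_(i <- s) c i *: v i].
Proof.
move=> s_uniq; apply/seteqP; split=> [|_ [c ->]]; last by exists s, c.
apply: lin_span_sub => [|i /= si]; first exact: subspace_combinations.
exists (fun j => (j == i)%:R); rewrite (bigD1_seq i)//= eqxx scale1r.
by rewrite big1 ?addr0// => j /negbTE->; rewrite scale0r.
Qed.

Lemma free_family_sub (T : eqType) (D E : set T) (v : T -> V) :
  E `<=` D -> free_family D v -> free_family E v.
Proof. by move=> ED vfree s c s_uniq sE; apply: vfree => // i /sE/ED. Qed.

(** The coefficients on ['I_m] are transported along [g] to coefficients on [T],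
    extended by zero outside the image of [g]. *)
Lemma free_family_comp (T : eqType) (D : set T) (v : T -> V) m (g : 'I_m -> T) :
  injective g -> (forall j, D (g j)) -> free_family D v ->
  free_family setT (v \o g).
Proof.
move=> g_inj gD vfree r c r_uniq _ r0 j jr.
pose c' x := if [pick j | g j == x] is Some j then c j else 0.
have c'g i : c' (g i) = c i.
  rewrite /c'; case: pickP => [i' /eqP/g_inj->//|/(_ i)].
  by rewrite eqxx.
rewrite -c'g; apply: (vfree (map g r)); last exact: map_f.
- by rewrite map_inj_uniq.
- by move=> _ /mapP[i _ ->].
- by rewrite big_map -[RHS]r0; apply: eq_bigr => i _; rewrite c'g.
Qed.

(** Steinitz: the coordinate matrix of a free family in a spanning list has a
    trivial left kernel, so it cannot have more rows than columns. *)
Lemma free_family_leq (T : eqType) (s : seq T) (v : T -> V) m (w : 'I_m -> V) :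
  free_family setT w -> (forall i, lin_span [set` s] v (w i)) ->
  (m <= size s)%N.
Proof.
move=> wfree ws; apply: leq_trans (size_undup s); set r := undup s.
have {}ws i : exists c : T -> k, w i = \sum_(x <- r) c x *: v x.
  have : lin_span [set` s] v (w i) by [].
  have -> : [set` s] = [set` r].
    by apply/seteqP; split=> x /=; rewrite mem_undup.
  by rewrite lin_span_uniq ?undup_uniq.
have {ws} /choice[c wc] := ws.
pose C : 'M[k]_(m, size r) := \matrix_(i, j) c i (tnth (in_tuple r) j).
rewrite leqNgt; apply/negP => rm.
have /rowV0Pn[a aC /negP[]] : kermx C != 0.
  rewrite -mxrank_eq0 mxrank_ker -lt0n subn_gt0.
  exact: leq_ltn_trans (rank_leq_col C) rm.
have {}aC : a *m C = 0 by apply/eqP; rewrite -sub_kermx.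
apply/eqP/rowP => i; rewrite [RHS]mxE.
apply: (wfree (index_enum _) (a 0)); rewrite ?index_enum_uniq ?mem_index_enum//.
under eq_bigr do rewrite wc big_tnth scaler_sumr.
rewrite exchange_big big1// => j _.
under eq_bigr do rewrite scalerA.
rewrite -scaler_suml; have /esym aCj : (a *m C) 0 j = 0 by rewrite aC mxE.
set e := (X in X *: _); suff -> : e = 0 by rewrite scale0r.
by rewrite aCj mxE; apply: eq_bigr => l _; rewrite mxE.
Qed.

(** Either [W] has a finite basis, and Steinitz bounds its length, or its
    dimension is the default value [0]. *)
Lemma dimension_leq (T : eqType) (s : seq T) (v : T -> V) (W : set V) :
  W `<=` lin_span [set` s] v -> (dimension W <= size s)%N.
Proof.
move=> Ws; rewrite /dimension; case: xgetP => [m _ [w [wfree wW]]|//].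
apply: (free_family_leq wfree) => i; apply: Ws; rewrite -wW.
exact: mem_lin_span.
Qed.

Lemma subspace_lin_span (T : eqType) (D : set T) (v : T -> V) :
  Defs.subspace (lin_span D v).
Proof.
split=> [|a _ _ [s [c [sD ->]]] [t [d [tD ->]]]].
  by exists [::], (fun=> 0); rewrite big_nil.
pose r := undup (s ++ t); have r_uniq : uniq r by exact: undup_uniq.
have rD i : i \in r -> D i by rewrite mem_undup mem_cat => /orP[/sD|/tD].
suff : lin_span [set` r] v
    (a *: (\sum_(i <- s) c i *: v i) + \sum_(i <- t) d i *: v i).
  by move=> [q [e [qr ->]]]; exists q, e; split=> // i /qr/rD.
rewrite lin_span_uniq//; have [_] := subspace_combinations r v; apply.
- rewrite -lin_span_uniq//; exists s, c; split=> // i si /=.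
  by rewrite mem_undup mem_cat si.
- rewrite -lin_span_uniq//; exists t, d; split=> // i ti /=.
  by rewrite mem_undup mem_cat ti orbT.
Qed.

(** Two finite bases span each other, so Steinitz applies in both directions. *)
Lemma dimension_basis (T : eqType) (s : seq T) (v : T -> V) (W : set V) :
  uniq s -> basis_family [set` s] v W -> dimension W = size s.
Proof.
move=> s_uniq [vfree vW]; pose g := tnth (in_tuple s).
have g_inj : injective g by exact/tuple_uniqP.
have gs j : g j \in s by exact: mem_tnth.
have basis_g : basis_family setT (v \o g) W.
  split; first exact: (free_family_comp g_inj gs vfree).
  rewrite -vW; apply/seteqP; split.
    apply: lin_span_sub => [|j _]; first exact: subspace_lin_span.
    exact/mem_lin_span/gs.
  rewrite lin_span_uniq// => _ [c ->].
  by exists (index_enum _), (c \o g); split; rewrite // big_tnth.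
apply/eqP; rewrite eqn_leq (@dimension_leq _ s v) ?vW//=.
rewrite /dimension; case: xgetP => [m _ [w [_ wW]]|]; last first.
  by move/(_ (size s)); case; exists (v \o g).
rewrite -[m]size_enum_ord.
apply: (free_family_leq (T := 'I_m) (v := w) basis_g.1) => j.
have -> : [set` enum 'I_m] = setT.
  by apply/seteqP; split=> // x _ /=; rewrite mem_enum.
by rewrite wW -basis_g.2; exact: mem_lin_span.
Qed.

End Dimension.

Lemma lin_span_image (k : fieldType) (V W : lmodType k) (h : {linear V -> W})
    (T : eqType) (D : set T) (v : T -> V) :
  lin_span D (h \o v) = h @` lin_span D v.
Proof.
apply/seteqP; split=> [_ [s [c [sD ->]]]|_ [_ [s [c [sD ->]]] <-]].
  exists (\sum_(i <- s) c i *: v i); first by exists s, c.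
  by rewrite linear_sum; apply: eq_bigr => i _; rewrite linearZ.
exists s, c; split=> //; rewrite linear_sum; apply: eq_bigr => i _.
by rewrite linearZ.
Qed.

(** * Coefficients and linear extension in the free algebra *)

Section FreeAlgebraTheory.
Variables (k : fieldType) (n : nat).
Local Notation word := (fmonom 'I_n).
Local Notation freealg := (freealg k n).
Local Notation mono := (@Defs.mono k n).
Implicit Types (u v : freealg) (w x : word).

(** [mcoeff] is linear for the scaling of [malg], which [freealg] hides behind a
    lock; [coeff] carries the linear structure over [freealg] itself. *)
Definition coeff w u : k := mcoeff w u.

Lemma freealgP u v : (forall w, coeff w u = coeff w v) -> u = v.
Proof. by move=> uv; apply/malgP. Qed.

Fact coeff_linear w : linear_for *%R (coeff w).
Proof.
move=> c u v; rewrite /coeff [LHS]mcoeffD; congr (_ + _).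
by rewrite freealg_scaleE freealg_scale.unlock [LHS]mcoeffZ.
Qed.

HB.instance Definition _ w :=
  GRing.isLinear.Build k freealg k *%R (coeff w) (coeff_linear w).

Lemma mem_msupp w u : (w \in msupp u) = (coeff w u != 0).
Proof. by rewrite mcoeff_neq0. Qed.

Lemma coeff_mono w x : coeff w (mono x) = (x == w)%:R.
Proof. by rewrite /coeff /mono freealg_mono.unlock mcoeffU. Qed.

Lemma msupp_mono w x : (x \in msupp (mono w)) = (x == w).
Proof.
rewrite mem_msupp coeff_mono.
by have [_|_] := eqVneq w x; rewrite /= ?oner_eq0 ?eqxx.
Qed.

Lemma mono1 : 1 = mono (FMonom [::]).
Proof. by rewrite /mono freealg_mono.unlock -fmoneE. Qed.

Lemma monoM w x : mono w * mono x = mono (FMonom (w ++ x)).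
Proof.
rewrite freealg_mulE freealg_mul.unlock /mono freealg_mono.unlock.
by rewrite malgM_def fgmulUU mulr1 -fmmulE.
Qed.

Lemma mono_cons i (s : seq 'I_n) :
  mono (FMonom (i :: s)) = gen k i * mono (FMonom s).
Proof. by rewrite monoM. Qed.

Lemma gen2 i j : gen k i * gen k j = mono (FMonom [:: i; j]).
Proof. by rewrite monoM. Qed.

Lemma freealg_sum u : u = \sum_(w <- msupp u) coeff w u *: mono w.
Proof.
apply: freealgP => x; rewrite linear_sum/=.
under eq_bigr do rewrite linearZ/= coeff_mono.
have [xu|] := boolP (x \in msupp u); last first.
  rewrite mem_msupp negbK => /eqP x0; rewrite x0 big1// => w _.
  by have [->|] := eqVneq w x; rewrite ?x0 ?mul0r ?mulr0.
rewrite (bigD1_seq x) ?fset_uniq//= eqxx mulr1 big1 ?addr0// => w /negbTE->.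
by rewrite mulr0.
Qed.

Section LinearExtension.
Variables (V : lmodType k) (g : word -> V).

(** The monomials form a basis of the free algebra: [linext] is the linear map
    sending the basis vector [mono w] to [g w]. *)
Definition linext u : V := \sum_(w <- msupp u) coeff w u *: g w.

Lemma linext_seq (s : seq word) u :
  uniq s -> {subset msupp u <= s} -> linext u = \sum_(w <- s) coeff w u *: g w.
Proof.
move=> s_uniq us; rewrite (bigID (mem (msupp u)))/= [X in _ + X]big1 ?addr0.
  rewrite -big_filter; apply: perm_big; apply: uniq_perm => [||w].
  - exact: fset_uniq.
  - exact: filter_uniq.
  - by rewrite mem_filter andb_idr// => /us.
by move=> w; rewrite mem_msupp negbK => /eqP->; rewrite scale0r.
Qed.

Fact linext_linear : linear linext.
Proof.
move=> c u v; pose s := undup (msupp u ++ msupp v ++ msupp (c *: u + v)).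
have s_uniq : uniq s by exact: undup_uniq.
rewrite !(@linext_seq s)//; last first.
- by move=> w; rewrite mem_undup !mem_cat => ->; rewrite ?orbT.
- by move=> w; rewrite mem_undup !mem_cat => ->; rewrite ?orbT.
- by move=> w; rewrite mem_undup !mem_cat => ->; rewrite ?orbT.
rewrite scaler_sumr -big_split; apply: eq_bigr => w _.
by rewrite linearP/= scalerDl scalerA.
Qed.

HB.instance Definition _ := 
  GRing.isLinear.Build k freealg V *:%R linext linext_linear.

Lemma linext_mono w : linext (mono w) = g w.
Proof.
rewrite (@linext_seq [:: w])//; last by move=> x; rewrite msupp_mono inE.
by rewrite big_seq1 coeff_mono eqxx scale1r.
Qed.

End LinearExtension.

Definition supported (D : set word) : set freealg :=
  [set u | forall w, w \in msupp u -> D w].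

Lemma subspace_supported (D : set word) : Defs.subspace (supported D).
Proof.
split=> [w|c u v uD vD w]; rewrite mem_msupp; first by rewrite linear0 eqxx.
rewrite linearP/=; have [w0|w0 _] := eqVneq (coeff w u) 0.
  by rewrite w0 mulr0 add0r -mem_msupp => /vD.
by apply: uD; rewrite mem_msupp.
Qed.

Lemma supported_mono (D : set word) w : supported D (mono w) <-> D w.
Proof.
split=> [|Dw x]; last by rewrite msupp_mono => /eqP->.
by apply; rewrite msupp_mono.
Qed.

Lemma lin_span_mono (D : set word) : lin_span D mono = supported D.
Proof.
apply/seteqP; split=> [|u uD]; last first.
  by exists (msupp u), (coeff^~ u); split=> //; exact: freealg_sum.
apply: lin_span_sub => [|w Dw]; first exact: subspace_supported.
exact/supported_mono.
Qed.

(** Every polynomial is a combination of monomials, so a linear property of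
    polynomials supported in [D] only has to be checked on the monomials in
    [D]. *)
Lemma supported_ind (D : set word) (P : set freealg) :
  Defs.subspace P -> (forall w, D w -> P (mono w)) -> supported D `<=` P.
Proof. by rewrite -lin_span_mono; exact: lin_span_sub. Qed.

Lemma freealg_ind (P : set freealg) :
  Defs.subspace P -> (forall w, P (mono w)) -> forall u, P u.
Proof. by move=> Psub Pmono u; apply: (@supported_ind setT). Qed.

Lemma supportedM (D E F : set word) u v :
  (forall w x, D w -> E x -> F (FMonom (w ++ x))) ->
  supported D u -> supported E v -> supported F (u * v).
Proof.
have [S0 SD] := subspace_supported F; move=> DEF Du Ev; move: u Du.
apply: (@supported_ind _ [set u | supported F (u * v)]) => [|w Dw].
  split=> [|c u u' Su Su'] /=; first by rewrite mul0r.
  by rewrite mulrDl -scalerAl; apply: SD.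
move: v Ev.
apply: (@supported_ind _ [set v | supported F (mono w * v)]) => [|x Ex].
  split=> [|c v v' Sv Sv'] /=; first by rewrite mulr0.
  by rewrite mulrDr -scalerAr; apply: SD.
by rewrite /= monoM; apply/supported_mono/DEF.
Qed.

Lemma mono_free : free_family setT (mono : word -> freealg).
Proof.
move=> s c s_uniq _ s0 w ws; have /= := congr1 (coeff w) s0.
rewrite linear0 linear_sum/= (bigD1_seq w)//= linearZ/= coeff_mono eqxx mulr1.
rewrite big1 ?addr0// => x /negbTE xw.
by rewrite linearZ/= coeff_mono xw mulr0.
Qed.

(** * Homogeneous components *)

Definition homog_part d : freealg -> freealg :=
  linext (fun w => if size w == d then mono w else 0).

Lemma coeff_homog_part d w u :
  coeff w (homog_part d u) = if size w == d then coeff w u else 0.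
Proof.
rewrite linear_sum/=; under eq_bigr do rewrite linearZ/=.
transitivity (if size w == d then
    \sum_(x <- msupp u) coeff x u * coeff w (mono x) else 0); last first.
  case: ifP => // _; rewrite [in RHS](freealg_sum u) linear_sum/=.
  by apply: eq_bigr => x _; rewrite linearZ.
case: ifPn => wd; [apply: eq_bigr|rewrite big1//]; move=> x _;
  case: ifPn => xd //; rewrite ?linear0 ?mulr0//=.
  rewrite coeff_mono (_ : x == w = false) ?mulr0//.
  by apply: contraNF xd => /eqP->.
rewrite coeff_mono (_ : x == w = false) ?mulr0//.
by apply: contraNF wd => /eqP<-.
Qed.

Lemma homog_part_homog d u : homogeneous d (homog_part d u).
Proof.
move=> w; rewrite mem_msupp coeff_homog_part.
by case: (size w =P d) => // _; rewrite eqxx.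
Qed.

Lemma sum_homog_part u : exists m, u = \sum_(d < m) homog_part d u.
Proof.
exists (\max_(w <- msupp u) (size w).+1)%N; apply: freealgP => w.
rewrite linear_sum/=; under eq_bigr do rewrite coeff_homog_part.
have [wu|] := boolP (w \in msupp u); last first.
  by rewrite mem_msupp negbK => /eqP w0; rewrite w0 big1// => d _; case: ifP.
have wm : (size w < \max_(x <- msupp u) (size x).+1)%N.
  exact: (@leq_bigmax_seq _ _ predT (fun x : word => (size x).+1)).
rewrite (bigD1 (Ordinal wm))//= eqxx big1 ?addr0// => d dw.
by case: eqP => // wd; case/eqP: dw; apply: val_inj.
Qed.

(** A word has a single length, so its coefficient is read off from one summand
    only. *)
Lemma homog_sum0 m (c : nat -> freealg) :
  (forall d, homogeneous d (c d)) -> \sum_(d < m) c d = 0 ->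
  forall d, (d < m)%N -> c d = 0.
Proof.
move=> ch c0 d dm; apply: freealgP => w; rewrite linear0.
have coeff_c e : size w != e -> coeff w (c e) = 0.
  by move=> we; apply/eqP; apply: contraNT we; rewrite -mem_msupp => /ch->.
have [wd|] := eqVneq (size w) d; last exact: coeff_c.
have /= := congr1 (coeff w) c0; rewrite linear0 linear_sum/=.
rewrite (bigD1 (Ordinal dm))//= big1 ?addr0// => e ed.
by apply: coeff_c; rewrite wd eq_sym.
Qed.

End FreeAlgebraTheory.

(** * Ideals and the collapsing map *)

Section Ideals.
Variable R : nzRingType.
Implicit Types (u v : R).

Lemma ideal_gen_sub (F J : set R) :
  two_sided_ideal J -> F `<=` J -> ideal_gen F `<=` J.
Proof. by move=> Jideal FJ u; apply. Qed.

Lemma sub_ideal_gen (F : set R) : F `<=` ideal_gen F.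
Proof. by move=> u Fu J [_]; apply. Qed.

Lemma ideal_opp (J : set R) u : two_sided_ideal J -> J u -> J (- u).
Proof. by move=> [_ _ JM _] Ju; rewrite -mulN1r; apply: JM. Qed.

Lemma ideal_sub (J : set R) u v :
  two_sided_ideal J -> J u -> J v -> J (u - v).
Proof.
move=> Jideal Ju Jv; have [_ JD _ _] := Jideal.
by apply: JD => //; exact: ideal_opp.
Qed.

End Ideals.

Section Collapse.
Variables (k : fieldType) (n : nat) (x1 : 'I_n).
Local Notation word := (fmonom 'I_n).
Local Notation freealg := (freealg k n).
Local Notation mono := (@Defs.mono k n).
Local Notation gen := (@Defs.gen k n).
Implicit Types (u v : freealg) (w x : word).

(** For a nonempty [w], the word [x_1^(d-1) x_m] which has the same length [d]
    and the same last letter [x_m] as [w]: the normal form of [w] modulo the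
    relations. *)
Definition collapse w : word :=
  FMonom (nseq (size w).-1 x1 ++ drop (size w).-1 w).

Arguments collapse : simpl never.

Lemma collapse_rcons (s : seq 'I_n) m :
  collapse (FMonom (rcons s m)) = pow_word x1 (size s) m.
Proof.
by rewrite /collapse /pow_word /= size_rcons /= -cats1 drop_size_cat// cats1.
Qed.

Lemma collapse_cons2 i j (s : seq 'I_n) :
  collapse (FMonom [:: i, j & s]) = FMonom (x1 :: collapse (FMonom (j :: s))).
Proof. by []. Qed.

Lemma size_collapse w : size (collapse w) = size w.
Proof.
case: w => s; rewrite /collapse /= size_cat size_nseq size_drop.
by case: s => //= i s; rewrite subSnn addn1.
Qed.

Lemma collapse_pow_word a m : collapse (pow_word x1 a m) = pow_word x1 a m.
Proof. by rewrite collapse_rcons size_nseq. Qed.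

Lemma collapseK w : collapse (collapse w) = collapse w.
Proof.
case: w => s; case/lastP: s => [//|s m].
by rewrite collapse_rcons collapse_pow_word.
Qed.

Lemma collapse_fixP w :
  collapse w = w <-> w = FMonom [::] \/ exists a m, w = pow_word x1 a m.
Proof.
split=> [<-|[->//|[a [m ->]]]]; last exact: collapse_pow_word.
case: w => s; case/lastP: s => [|s m]; first by left.
by right; exists (size s), m; rewrite collapse_rcons.
Qed.

(** Collapsing only depends on the length and on the last letter, and collapsing
    a factor preserves both for the whole word. This makes collapsing compatible
    with concatenation, hence the kernel of [red] an ideal. *)
Lemma collapse_catr w x :
  collapse (FMonom (w ++ collapse x)) = collapse (FMonom (w ++ x)).
Proof.
case: x => s; case/lastP: s => [//|s m].
by rewrite collapse_rcons /= -!rcons_cat !collapse_rcons !size_cat size_nseq.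
Qed.

Lemma collapse_catl w x :
  collapse (FMonom (collapse w ++ x)) = collapse (FMonom (w ++ x)).
Proof.
case: x => s; case/lastP: s => [|s m].
  by rewrite !cats0 fmK collapseK; case: w.
rewrite /= -!rcons_cat !collapse_rcons [size (collapse w ++ s)]size_cat.
by rewrite size_collapse -size_cat.
Qed.

Definition red : freealg -> freealg := linext (fun w => mono (collapse w)).

HB.instance Definition _ := GRing.Linear.on red.

Lemma red_mono w : red (mono w) = mono (collapse w).
Proof. exact: linext_mono. Qed.

Lemma redK u : red (red u) = red u.
Proof.
move: u; apply: freealg_ind => [|w]; last by rewrite !red_mono collapseK.
by split=> [|c u v /= uE vE]; rewrite ?linear0// !linearP/= uE vE.
Qed.

Lemma red_mulr u v : red (u * red v) = red (u * v).
Proof.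
move: u; apply: freealg_ind => [|w].
  split=> [|c u u' /= uE u'E]; rewrite ?mul0r//.
  by rewrite !mulrDl -!scalerAl !linearP/= uE u'E.
move: v; apply: freealg_ind => [|x].
  split=> [|c v v' /= vE v'E]; rewrite ?linear0//.
  by rewrite linearP/= !mulrDr -!scalerAr !linearP/= vE v'E.
by rewrite red_mono !monoM !red_mono collapse_catr.
Qed.

Lemma red_mull u v : red (red u * v) = red (u * v).
Proof.
move: u; apply: freealg_ind => [|w].
  split=> [|c u u' /= uE u'E]; rewrite ?linear0 ?mul0r//.
  by rewrite linearP/= !mulrDl -!scalerAl !linearP/= uE u'E.
move: v; apply: freealg_ind => [|x].
  split=> [|c v v' /= vE v'E]; rewrite ?mulr0//.
  by rewrite !mulrDr -!scalerAr !linearP/= vE v'E.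
by rewrite red_mono !monoM !red_mono collapse_catl.
Qed.

Lemma supported_red (D : set word) u :
  (forall w, D w -> D (collapse w)) -> supported D u -> supported D (red u).
Proof.
move=> Dc; move: u; have [S0 SD] := @subspace_supported k n D.
apply: (@supported_ind k n _ [set u | supported D (red u)]) => [|w Dw] /=.
  by split=> [|c v v' Sv Sv'] /=; rewrite ?linear0// linearP; apply: SD.
by rewrite red_mono; apply/supported_mono/Dc.
Qed.

Definition red_ker : set freealg := [set u | red u = 0].

Lemma red_ker_ideal : two_sided_ideal red_ker.
Proof.
split=> [|u v u0 v0|a u u0|a u u0]; rewrite /red_ker /=.
- exact: linear0.
- by rewrite linearD /= u0 v0 addr0.
- by rewrite -red_mulr u0 mulr0 linear0.
- by rewrite -red_mull u0 mul0r linear0.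
Qed.

Lemma red_sub u : red_ker (u - red u).
Proof. by rewrite /red_ker /= linearB/= redK subrr. Qed.

Lemma red_ker_rel j p : red_ker (gen j * gen p - gen x1 * gen p).
Proof. by rewrite !gen2 /red_ker /= linearB/= !red_mono subrr. Qed.

(** Modulo [x_j x_p - x_1 x_p], the letters of a word that are followed by
    another letter turn into [x_1] one after the other. *)
Lemma ideal_red (J : set freealg) :
  two_sided_ideal J ->
  (forall j p, J (gen j * gen p - gen x1 * gen p)) -> forall u, J (u - red u).
Proof.
move=> [J0 JD JMl JMr] Jrel; apply: freealg_ind => [|[s]].
  split=> [|c u v /= Ju Jv]; first by rewrite linear0 subr0.
  rewrite linearP/= opprD addrACA -scalerBr; apply: JD => //.
  by rewrite -[_ - _]mul1r scalerAl; apply: JMl.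
rewrite /= red_mono; elim: s => [|i s IHs]; first by rewrite subrr.
case: s IHs => [|j s] IHs; first by rewrite subrr.
rewrite collapse_cons2 !mono_cons fmK.
set a := gen i; set b := gen j; set c := gen x1; set t := mono (FMonom s).
have -> : a * (b * t) - c * mono (collapse (FMonom (j :: s))) =
    (a * b - c * b) * t +
    c * (mono (FMonom (j :: s)) - mono (collapse (FMonom (j :: s)))).
  by rewrite mono_cons mulrBl mulrBr !mulrA addrA subrK.
by apply: JD; [exact/JMr/Jrel|exact/JMl].
Qed.

Lemma ideal_gen_red_ker (F : set freealg) :
  F `<=` red_ker ->
  (forall j p, ideal_gen F (gen j * gen p - gen x1 * gen p)) ->
  ideal_gen F = red_ker.
Proof.
move=> Fker Frel; have Iideal := ideal_gen_ideal F.
apply/seteqP; split; first exact: ideal_gen_sub red_ker_ideal Fker.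
by move=> u u0; rewrite -[u]subr0 -u0; apply: ideal_red.
Qed.

Lemma ideal_standard : ideal_gen (standard_relations k x1) = red_ker.
Proof.
apply: ideal_gen_red_ker => [_ [j [p [_ ->]]]|j p]; first exact: red_ker_rel.
have [->|/eqP jx1] := eqVneq j x1.
  by rewrite subrr; have [] := ideal_gen_ideal (standard_relations k x1).
by apply: sub_ideal_gen; exists j, p.
Qed.

(** The relations [x_j x_p = f(x_p) x_p] and [x_1 x_p = f(x_p) x_p] have the
    same right-hand side, so their difference is the standard relation. *)
Lemma ideal_yb (f : {perm 'I_n}) :
  ideal_gen (yb_relations k (perm_solution f)) = red_ker.
Proof.
apply: ideal_gen_red_ker => [_ [j [p ->]]|j p] /=.
  by rewrite !gen2 /red_ker /= linearB/= !red_mono subrr.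
set F := yb_relations _ _.
have FE i : ideal_gen F (gen i * gen p - gen (f p) * gen p).
  by apply: sub_ideal_gen; exists i, p.
have -> : gen j * gen p - gen x1 * gen p =
    (gen j * gen p - gen (f p) * gen p) - (gen x1 * gen p - gen (f p) * gen p).
  by rewrite opprB addrA subrK.
exact: ideal_sub (ideal_gen_ideal F) (FE j) (FE x1).
Qed.

End Collapse.

Arguments collapse {n} x1 w : simpl never.

(** * The Groebner basis *)

Section Deglex.
Variable (n : nat).
Local Notation word := (fmonom 'I_n).
Implicit Types (v w x : word).

Lemma deglexE v w : size v = size w ->
  deglex v w = (((v : seq 'I_n) : seqlexi 'I_n) < (w : seq 'I_n))%O.
Proof. by move=> vw; rewrite /deglex vw ltnn eqxx. Qed.

Lemma deglex_nsym v w : deglex v w -> ~~ deglex w v.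
Proof.
have [vw|neq_vw] := eqVneq (size v) (size w).
  by rewrite !deglexE// => /lt_nsym vw'; apply/negP.
rewrite /deglex (negbTE neq_vw) eq_sym (negbTE neq_vw) !orbF -leqNgt.
exact: ltnW.
Qed.

Lemma deglex_pow_word (y i j : 'I_n) a :
  (i < j)%N -> deglex (pow_word y a i) (pow_word y a j).
Proof.
move=> ij; rewrite deglexE ?size_rcons//=.
elim: a => [|a IHa] /=; last by rewrite eqhead_ltxiE.
by rewrite neqhead_ltxiE// neq_ltn ij.
Qed.

Variable x1 : 'I_n.
Hypothesis x1_min : forall i : 'I_n, (x1 <= i)%N.

(** Collapsing replaces letters by the smallest one, so it cannot increase a
    word. *)
Lemma deglex_collapse w : collapse x1 w != w -> deglex (collapse x1 w) w.
Proof.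
move=> neq_w; rewrite deglexE ?size_collapse// lt_neqAle neq_w andTb.
case: w {neq_w} => s; elim: s => [|i [|j s] IHs] //.
by rewrite collapse_cons2 lexi_cons leEord x1_min IHs implybT.
Qed.

(** Collapsing can only move a letter that differs from [x1] and is not the last
    one; together with its successor it is the leading monomial of a standard
    relation. *)
Lemma collapse_infix w : collapse x1 w != w ->
  exists j p, j <> x1 /\ infix (FMonom [:: j; p]) w.
Proof.
case: w => s; elim: s => [|i [|j s] IHs]; rewrite ?eqxx//.
have [->|/eqP ix1] := eqVneq i x1; last first.
  by exists i, j; split=> //; rewrite /= !eqxx prefix0s.
move=> neq_s.
have /IHs[a [b [ax1 ab]]] : collapse x1 (FMonom (j :: s)) != FMonom (j :: s).
  by apply: contraNneq neq_s => js; rewrite collapse_cons2 js.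
by exists a, b; split=> //; exact: infix_trans ab (infix_cons _ _).
Qed.

Lemma infix_pow_word j p a m :
  infix (FMonom [:: j; p]) (pow_word x1 a m) -> j = x1.
Proof.
elim: a => [|a IHa]; first by rewrite infixs1 eqseq_cons andbF.
by rewrite [infix _ _]/= => /orP[/andP[/eqP]|].
Qed.

End Deglex.

Section Groebner.
Variables (k : fieldType) (n : nat) (x1 : 'I_n).
Hypothesis x1_min : forall i : 'I_n, (x1 <= i)%N.
Local Notation word := (fmonom 'I_n).
Local Notation freealg := (freealg k n).
Local Notation mono := (@Defs.mono k n).
Local Notation gen := (@Defs.gen k n).
Local Notation I := (red_ker x1 : set freealg).
Local Notation Re := (standard_relations k x1).
Implicit Types (u : freealg) (v w x : word).

Lemma lead_mono_inj u v w : lead_mono u v -> lead_mono u w -> v = w.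
Proof.
move=> [uv v_max] [uw w_max]; apply/eqP; apply/negPn/negP => vw.
have wv : deglex w v by apply: v_max; rewrite // eq_sym.
by move: (deglex_nsym wv); rewrite w_max.
Qed.

Lemma msupp_monoB v w x : v != w ->
  (x \in msupp (mono w - mono v)) = (x == w) || (x == v).
Proof.
move=> vw; rewrite mem_msupp linearB/= !coeff_mono.
have [->|xw] := eqVneq x w.
  by rewrite (negbTE vw) subr0 oner_eq0.
rewrite sub0r oppr_eq0.
by have [_|_] := eqVneq x v; rewrite /= ?oner_eq0 ?eqxx.
Qed.

Lemma lead_monoB v w : deglex v w -> lead_mono (mono w - mono v) w.
Proof.
move=> vw; have neq_vw : v != w.
  by apply: contraL vw => /eqP->; rewrite /deglex !ltnn eqxx ltxx.
split=> [|x]; rewrite msupp_monoB// ?eqxx//.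
by move=> /orP[->//|/eqP-> _].
Qed.

(** In a polynomial killed by [red], the largest word [w] cannot be collapsed:
    the other words with the same collapse would all be larger than [w], so the
    coefficient of [w] would be a coefficient of the reduction. *)
Lemma lead_monos_red_ker : lead_monos I = [set w | collapse x1 w != w].
Proof.
apply/seteqP; split=> [w [u u0 [wu w_max]]|w /= cw]; last first.
  exists (mono w - mono (collapse x1 w)); last exact/lead_monoB/deglex_collapse.
  by rewrite -red_mono; exact: red_sub.
apply/negP => /eqP cw; have := wu; rewrite mem_msupp => /negP[]; apply/eqP.
have /(congr1 (coeff w)) := u0; rewrite linear0 => <-.
rewrite linear_sum/= (bigD1_seq w) ?fset_uniq//= linearZ/= cw coeff_mono eqxx.
rewrite mulr1 big_seq_cond big1 ?addr0// => v /andP[vu vw].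
rewrite linearZ/= coeff_mono; case: eqP => [cv|]; last by rewrite mulr0.
have : deglex w v.
  rewrite -[X in deglex X]cv; apply: (deglex_collapse x1_min).
  by rewrite cv eq_sym.
by move=> /deglex_nsym/negP[]; exact: w_max.
Qed.

Lemma normal_words_red_ker :
  normal_words I = [set w | collapse x1 w = w].
Proof.
rewrite /normal_words lead_monos_red_ker; apply/seteqP; split=> w /=.
  by move=> w_normal; apply/eqP/negPn/negP => /w_normal; rewrite infix_refl.
move=> /collapse_fixP wE v /collapse_infix[j [p [jx1 jpv]]].
apply/negP => /(infix_trans jpv); case: wE => [->|[a [m ->]] /infix_pow_word//].
by rewrite infixs0.
Qed.

Lemma lead_mono_rel j p : j <> x1 ->
  lead_mono (gen j * gen p - gen x1 * gen p) (FMonom [:: j; p]).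
Proof.
move=> jx1; rewrite !gen2; apply: lead_monoB; rewrite deglexE//.
rewrite /= neqhead_ltxiE; last by apply/eqP => /esym.
by rewrite lt_neqAle leEord x1_min andbT; apply/eqP => /esym.
Qed.

Lemma lead_mono_rel_eq j p w : j <> x1 ->
  lead_mono (gen j * gen p - gen x1 * gen p) w -> w = FMonom [:: j; p].
Proof. by move=> /(@lead_mono_rel _ p) jp /lead_mono_inj/(_ jp). Qed.

Lemma monic_rel j p : j <> x1 -> is_monic (gen j * gen p - gen x1 * gen p).
Proof.
move=> jx1; exists (FMonom [:: j; p]); first exact: lead_mono_rel.
rewrite -[LHS]/(coeff _ _) !gen2 linearB/= !coeff_mono eqxx.
by case: eqP => [[/esym]//|]; rewrite subr0.
Qed.

Lemma msupp_rel j p w : j <> x1 ->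
  (w \in msupp (gen j * gen p - gen x1 * gen p)) =
  (w == FMonom [:: j; p]) || (w == FMonom [:: x1; p]).
Proof.
by move=> jx1; rewrite !gen2 msupp_monoB//; apply/eqP => -[/esym].
Qed.

Lemma standard_groebner : groebner_basis I Re.
Proof.
split=> [_ [j [p [jx1 ->]]]| |w]; first exact: monic_rel.
  exact: ideal_standard.
rewrite lead_monos_red_ker => /collapse_infix[j [p [jx1 jpw]]].
exists (FMonom [:: j; p]) => //; exists (gen j * gen p - gen x1 * gen p).
  by exists j, p.
exact: lead_mono_rel.
Qed.

Lemma lead_mono_standard v g : Re g -> lead_mono g v ->
  exists j p, [/\ j <> x1, v = FMonom [:: j; p]
                & g = gen j * gen p - gen x1 * gen p].
Proof.
by move=> [j [p [jx1 ->]]] /(lead_mono_rel_eq jx1)->; exists j, p.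
Qed.

Lemma infix_size_eq (v w : word) : infix v w -> size v = size w -> v = w.
Proof.
case: v w => [v] [w] /= /infixP[s [t ->]] /eqP.
rewrite !size_cat addnCA -[X in X == _]addn0 eqn_add2l eq_sym addn_eq0.
by rewrite !size_eq0 => /andP[/eqP-> /eqP->]; rewrite cats0.
Qed.

(** The leading monomials of the standard relations are pairwise distinct words
    of length 2, so one of them is a subword of another word of length 2 only
    if the two words are equal. *)
Lemma standard_reduced : reduced_groebner_basis I Re.
Proof.
split; first exact: standard_groebner.
  move=> g [j [p [jx1 gE]]] [_ _] /(_ (FMonom [:: j; p])).
  case=> [|v [h [Reh hg] hv] vjp].
    rewrite lead_monos_red_ker /=; apply/eqP => -[/esym]; exact: jx1.
  have [a [b [ax1 vE hE]]] := lead_mono_standard Reh hv.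
  rewrite vE in vjp; have [aj bp] := infix_size_eq vjp erefl.
  by apply: hg; rewrite gE hE aj bp.
move=> g [j [p [jx1 gE]]] w wg v [h [Reh hg] hv]; apply/negP => vw.
have [a [b [ax1 vE hE]]] := lead_mono_standard Reh hv.
rewrite vE in vw; move: wg; rewrite gE msupp_rel// => /orP[]/eqP wE;
  rewrite wE in vw; have [aj bp] := infix_size_eq vw erefl => //.
by apply: hg; rewrite gE hE aj bp.
Qed.

Lemma homogeneous_rel j p : homogeneous 2 (gen j * gen p - gen x1 * gen p).
Proof.
rewrite !gen2; have [->|jx1] := eqVneq j x1.
  by rewrite subrr => w; rewrite mem_msupp linear0 eqxx.
move=> w; rewrite msupp_monoB; first by case/orP=> /eqP->.
by apply/eqP=> -[/esym/eqP]; rewrite (negbTE jx1).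
Qed.

Lemma binomial_rel j p : j <> x1 ->
  is_binomial (gen j * gen p - gen x1 * gen p).
Proof.
move=> jx1; exists (FMonom [:: j; p]), (FMonom [:: x1; p]); split=> [[]//|w].
by rewrite msupp_rel//; split=> [/orP[]/eqP->|[]->]; rewrite ?eqxx ?orbT; auto.
Qed.

Lemma PBW_red_ker : PBW I.
Proof.
have Rehom : Re `<=` homogeneous 2.
  by move=> _ [j [p [_ ->]]]; exact: homogeneous_rel.
by split; exists Re => //; [exact: ideal_standard|exact: standard_groebner].
Qed.

(** A relation [x_j x_p - x_1 x_p] with [x_j] different from [x_1] determines
    the pair [(j, p)] through its leading monomial. *)
Lemma card_standard : (Re #= `I_(n * (n - 1)))%card.
Proof.
pose S := [predX predC1 x1 & 'I_n].
pose rel (q : 'I_n * 'I_n) := gen q.1 * gen q.2 - gen x1 * gen q.2.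
have cardS : (n * (n - 1))%N = #|S|.
  by rewrite cardX cardC1 card_ord subn1 mulnC.
have -> : Re = range (rel \o enum_val : 'I_#|S| -> freealg).
  apply/seteqP; split=> [_ [j [p [jx1 ->]]]|_ [t _ <-]].
    have Sjp : (j, p) \in S by rewrite !inE andbT; exact/eqP.
    by exists (enum_rank_in Sjp (j, p)); rewrite //= enum_rankK_in.
  have := enum_valP t; rewrite !inE andbT => /eqP tx1.
  by exists (enum_val t).1, (enum_val t).2.
rewrite cardS; apply: card_eq_trans (card_esym card_II).
apply: inj_card_eq => t t' _ _ /= tt'; apply: enum_val_inj.
have := enum_valP t; have := enum_valP t'.
rewrite !inE !andbT => /eqP t'x1 /eqP tx1.
have := lead_mono_rel (enum_val t).2 tx1.
rewrite -/(rel _) tt' => /(lead_mono_rel_eq t'x1)[].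
by case: (enum_val t) (enum_val t') => [a b] [a' b'] /= -> ->.
Qed.

End Groebner.

(** * The quotient algebra and its normal form *)

Section Quotient.
Variables (k : fieldType) (n : nat) (x1 : 'I_n).
Variable J : Defs.proper_ideal (freealg k n).
Hypothesis x1_min : forall i : 'I_n, (x1 <= i)%N.
Hypothesis JE : ideal_set J = red_ker x1.
Local Notation word := (fmonom 'I_n).
Local Notation freealg := (freealg k n).
Local Notation mono := (@Defs.mono k n).
Local Notation I := (red_ker x1 : set freealg).
Local Notation red := (@red k n x1).
Local Notation A := (@quot_alg k freealg J).
Local Notation pi := (@quot_proj k freealg J).
Local Notation A_ := (quot_component J).
Implicit Types (u v : freealg) (w : word) (a b : A).

Lemma normal_spanP u : normal_span I u <-> red u = u.
Proof.
rewrite /normal_span lin_span_mono (normal_words_red_ker _ x1_min); split.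
  move: u; apply: (@supported_ind k n _ [set u | red u = u]) => [|w /= wN].
    by split=> [|c v v' /= vE v'E]; rewrite /= ?linear0// linearP/= vE v'E.
  by rewrite red_mono wN.
move=> <-; move: u; apply: freealg_ind => [|w].
  have [S0 SD] := @subspace_supported k n [set w | collapse x1 w = w].
  by split=> [|c v v' Sv Sv'] /=; rewrite ?linear0// linearP; apply: SD.
by rewrite red_mono; apply/supported_mono; exact: collapseK.
Qed.

Lemma normal_span_degP d u :
  normal_span_deg I d u <-> normal_span I u /\ homogeneous d u.
Proof.
rewrite /normal_span_deg /normal_span !lin_span_mono.
split=> [uNd|[uN ud] w wu].
  by split=> w /uNd[].
by split; [exact: uN|exact: ud].
Qed.

Lemma red_homogeneous d u : homogeneous d u -> homogeneous d (red u).
Proof.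
apply: (@supported_red k n x1 [set w | size w = d]) => w /=.
by rewrite size_collapse.
Qed.

(** The inverse of the projection on the normal span: as [red] vanishes on the
    ideal, its value does not depend on the representative of the class. *)
Definition quot_red a : freealg := red (quot_lift a).
Local Notation phi := quot_red.

Lemma quot_red_proj u : phi (pi u) = red u.
Proof.
have := quot_lift_proj J u; rewrite JE /red_ker /= linearB/= => /eqP.
by rewrite subr_eq0 => /eqP.
Qed.

Lemma quot_proj_red u : pi (red u) = pi u.
Proof.
by apply/esym/quot_projE; rewrite JE; exact: red_sub.
Qed.

Lemma quot_redK a : pi (phi a) = a.
Proof. by rewrite /quot_red quot_proj_red quot_liftK. Qed.

Fact quot_red_linear : linear phi.
Proof.
move=> c a b; rewrite -[a]quot_liftK -[b]quot_liftK -linearP /=.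
by rewrite !quot_red_proj linearP.
Qed.

HB.instance Definition _ :=
  GRing.isLinear.Build k A freealg *:%R phi quot_red_linear.

Lemma normal_quot_red a : normal_span I (phi a).
Proof. by apply/normal_spanP; rewrite redK. Qed.

(** Two normal polynomials with difference in the ideal are equal, since [red]
    fixes both and vanishes on the difference. *)
Lemma NorE u : Nor I u = red u.
Proof.
rewrite /Nor; apply: xget_unique.
  by split; [apply/normal_spanP; exact: redK|exact: red_sub].
move=> v [/normal_spanP vN]; rewrite /red_ker /= linearB/= vN => /eqP.
by rewrite subr_eq0 => /eqP.
Qed.

Lemma normal_mono_free : free_family (normal_words I) (fun w => pi (mono w)).
Proof.
rewrite (normal_words_red_ker _ x1_min) => s c s_uniq sN s0.
apply: (@mono_free k n) => //; have /(congr1 phi) := s0.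
rewrite linear0 linear_sum/= => s0'; rewrite -[RHS]s0'.
apply: eq_big_seq => w /sN /= wN.
by rewrite linearZ/= quot_red_proj red_mono wN.
Qed.

Lemma quot_image_normal : pi @` normal_span I = setT.
Proof.
apply/seteqP; split=> // a _; exists (phi a); first exact: normal_quot_red.
exact: quot_redK.
Qed.

Lemma quot_image_normal_deg d : pi @` normal_span_deg I d = A_ d.
Proof.
apply/seteqP; split=> _ [u + <-].
  by move=> /normal_span_degP[_ ud]; exists u.
move=> ud; exists (red u); last exact: quot_proj_red.
apply/normal_span_degP; split; last exact: red_homogeneous.
by apply/normal_spanP; exact: redK.
Qed.

Lemma normal_basis : basis_family (normal_words I) (fun w => pi (mono w)) setT.
Proof.
split; first exact: normal_mono_free.
by rewrite -quot_image_normal -lin_span_image.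
Qed.

Lemma normal_deg_basis d :
  basis_family (normal_words_deg I d) (fun w => pi (mono w)) (A_ d).
Proof.
split; first by apply: free_family_sub normal_mono_free => w [].
by rewrite -quot_image_normal_deg -lin_span_image.
Qed.

Lemma quot_red_deg d a : A_ d a -> homogeneous d (phi a).
Proof. by move=> [u ud <-]; rewrite quot_red_proj; exact: red_homogeneous. Qed.

Lemma homogeneousM i j u v :
  homogeneous i u -> homogeneous j v -> homogeneous (i + j) (u * v).
Proof. by apply: supportedM => w x /= wi xj; rewrite size_cat wi xj. Qed.

(** The sum of the components is direct because [quot_red] maps them into
    distinct homogeneous components of the free algebra and is injective. *)
Lemma quot_graded : graded_algebra A_.
Proof.
have sub_hom d : @Defs.subspace k freealg (homogeneous d).
  exact: (@subspace_supported k n [set w | size w = d]).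
split; last 1 first.
- move=> i j _ _ [u ui <-] [v vj <-]; exists (u * v); first exact: homogeneousM.
  exact: rmorphM.
- split=> [d|a|m c cd].
  + have [S0 SD] := sub_hom d; split; first by exists 0; rewrite ?linear0.
    move=> c _ _ [u ud <-] [v vd <-]; exists (c *: u + v); first exact: SD.
    exact: linearP.
  + split=> // _; have [m aE] := sum_homog_part (phi a).
    exists m, (fun d => pi (homog_part d (phi a))); split=> [d|].
      by exists (homog_part d (phi a)); first exact: homog_part_homog.
    by rewrite -[LHS]quot_redK [in LHS]aE linear_sum.
  + move=> c0 d dm; rewrite -[c d]quot_redK.
    have -> : phi (c d) = 0; last exact: linear0.
    apply: (@homog_sum0 k n m (phi \o c)) dm => [e|]; first exact: quot_red_deg.
    by rewrite -[RHS](linear0 phi) -c0 linear_sum.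
- exists 1; last exact: rmorph1.
  by rewrite mono1 => w; rewrite msupp_mono => /eqP->.
Qed.

Lemma normal_direct_sum : direct_sum (normal_span I) (normal_span_deg I).
Proof.
split=> [d|u|m c cd].
- rewrite /normal_span_deg lin_span_mono; exact: (@subspace_supported k n).
- split=> [uN|[m [c [cd ->]]]].
    have [m uE] := sum_homog_part u.
    exists m, (fun d => red (homog_part d u)); split=> [d|].
      apply/normal_span_degP; split; first by apply/normal_spanP; exact: redK.
      exact/red_homogeneous/homog_part_homog.
    by rewrite -linear_sum/= -uE; apply/esym/normal_spanP.
  apply/normal_spanP; rewrite linear_sum; apply: eq_bigr => d _.
  by apply/normal_spanP; have /normal_span_degP[] := cd d.
- by apply: homog_sum0 => d; have /normal_span_degP[] := cd d.
Qed.

Lemma quot_red_iso :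
  graded_iso_onto A_ (normal_span I) 1 (normal_mul I) (normal_span_deg I)
    (phi : {linear A -> freealg}).
Proof.
split=> [|||a b|d].
- exact: can_inj quot_redK.
- apply/seteqP; split=> [_ [a _ <-]|u /normal_spanP uN].
    exact: normal_quot_red.
  by exists (pi u); rewrite //= quot_red_proj.
- have -> : (1 : A) = pi 1 by rewrite rmorph1.
  rewrite /= quot_red_proj mono1 red_mono.
  by congr (mono _); apply/collapse_fixP; left.
- rewrite /normal_mul NorE -quot_red_proj.
  by have -> : pi (phi a * phi b) = a * b by rewrite rmorphM/= !quot_redK.
- apply/seteqP; split=> [_ [a ad <-]|u /normal_span_degP[/normal_spanP uN ud]].
    apply/normal_span_degP; split; first exact: normal_quot_red.
    exact: quot_red_deg.
  by exists (pi u); [exists u|rewrite /= quot_red_proj].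
Qed.

End Quotient.

(** * Growth of sequences *)

Section LogarithmicGrowth.
Variables (R : realType) (h : nat -> nat).
Local Notation log_ratio := (fun d => (ln (h d)%:R / ln d%:R : R)%:E).
Local Notation log_growth := (limn_esup log_ratio).

(** The quotient of the logarithms is at most [1 + ln c / ln d], and [ln d]
    eventually exceeds [ln c / e] for every [e > 0]. *)
Lemma log_growth_le1 (c : nat) :
  (forall d, (0 < d)%N -> (h d <= c * d)%N) -> (log_growth <= 1%:E)%E.
Proof.
move=> hc; apply/lee_addgt0Pr => e e0.
(* beyond this N, the logarithm of d is at least ln c / e *)
have [N ltN] : exists N : nat, expR (ln c%:R / e) < N%:R :> R.
  by exists (Num.bound (expR (ln c%:R / e))); exact: archi_boundP (expR_ge0 _).
pose V := [set d : nat | (maxn 2 N <= d)%N].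
rewrite -EFinD; apply: (@le_trans _ _ (ereal_sup (log_ratio @` V))).
  by apply: ereal_inf_lbound; exists V => //; exists (maxn 2 N).
apply: ge_ereal_sup => _ [d + <-]; rewrite /V /= geq_max => /andP[d2 Nd].
have d0 : (0 < d)%N by exact: ltnW.
have ln_d : 0 < ln d%:R :> R by rewrite ln_gt0// ltr1n.
rewrite lee_fin ler_pdivrMr// mulrDl mul1r.
have [->|hd0] := posnP (h d).
  by rewrite ln0// addr_ge0 ?mulr_ge0 ?ltW.
have c0 : (0 < c)%N.
  by move: (leq_trans hd0 (hc d d0)); rewrite muln_gt0 => /andP[].
apply: (@le_trans _ _ (ln (c * d)%:R)).
  by rewrite ler_ln ?posrE ?ltr0n ?muln_gt0 ?c0// ler_nat hc.
rewrite natrM lnM ?posrE ?ltr0n// addrC lerD2l.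
rewrite -ler_pdivrMl// mulrC -[leLHS]expRK ler_ln ?posrE ?expR_gt0 ?ltr0n//.
by rewrite (le_trans (ltW ltN))// ler_nat.
Qed.

Lemma log_growth_ge1 : (forall d, (d <= h d)%N) -> (1%:E <= log_growth)%E.
Proof.
move=> dh; apply: le_ereal_inf_tmp => _ [V [N _ NV] <-].
pose d := maxn 2 N; have d0 : (0 < d)%N by rewrite leq_max.
have ln_d : 0 < ln d%:R :> R by rewrite ln_gt0// ltr1n leq_max.
apply: (@le_trans _ _ (ln (h d)%:R / ln d%:R)%:E); last first.
  apply: ereal_sup_ubound; exists d => //; apply: NV.
  by rewrite /= leq_max leqnn orbT.
rewrite lee_fin ler_pdivlMr// mul1r ler_ln ?posrE ?ltr0n ?ler_nat//.
exact: leq_trans (dh d).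
Qed.

End LogarithmicGrowth.

(** * Hilbert function and Gelfand-Kirillov dimension *)

Section Growth.
Variables (k : fieldType) (n : nat) (x1 : 'I_n).
Variable J : Defs.proper_ideal (freealg k n).
Hypothesis x1_min : forall i : 'I_n, (x1 <= i)%N.
Hypothesis JE : ideal_set J = red_ker x1.
Local Notation word := (fmonom 'I_n).
Local Notation freealg := (freealg k n).
Local Notation mono := (@Defs.mono k n).
Local Notation I := (red_ker x1 : set freealg).
Local Notation A := (@quot_alg k freealg J).
Local Notation pi := (@quot_proj k freealg J).
Local Notation A_ := (quot_component J).
Local Notation phi := (@quot_red k n x1 J).

Definition normal_seq d : seq word :=
  if d is a.+1 then [seq pow_word x1 a m | m <- enum 'I_n]
  else [:: FMonom [::]].

Lemma pow_word_inj a : injective (pow_word x1 a).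
Proof. by move=> i j [/rcons_inj[]]. Qed.

Lemma normal_seq_uniq d : uniq (normal_seq d).
Proof.
case: d => //= a; rewrite map_inj_uniq ?enum_uniq//; exact: pow_word_inj.
Qed.

Lemma size_normal_seq d : size (normal_seq d) = if d == 0%N then 1%N else n.
Proof. by case: d => //= a; rewrite size_map size_enum_ord. Qed.

Lemma normal_words_degE d : normal_words_deg I d = [set` normal_seq d].
Proof.
rewrite /normal_words_deg (normal_words_red_ker _ x1_min).
apply/seteqP; split=> w /=.
  move=> [/collapse_fixP[->|[a [m ->]]] <-]; first by rewrite /= mem_head.
  by rewrite size_rcons size_nseq /=; apply: map_f; rewrite mem_enum.
case: d => [|a] /=.
  by rewrite inE => /eqP->; split=> //; apply/collapse_fixP; left.
by move=> /mapP[m _ ->]; rewrite collapse_pow_word size_rcons size_nseq.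
Qed.

Lemma hilbert_functionE d :
  hilbert_function A_ d = if d == 0%N then 1%N else n.
Proof.
rewrite -size_normal_seq; apply: dimension_basis; first exact: normal_seq_uniq.
by rewrite -normal_words_degE; exact: normal_deg_basis.
Qed.

(** The coefficient of [t^d] in [H(t) (1 - t)] is [h(d) - h(d-1)], which
    vanishes as soon as [d >= 2]. *)
Lemma hilbert_series_frac :
  series_eq_frac (hilbert_series A_) (1 + (n%:Z - 1)%:P * 'X) (1 - 'X).
Proof.
split; first by rewrite coefB coef1 coefX subr0 unitr1.
have HE d : hilbert_series A_ d = (if d == 0%N then 1%N else n)%:Z.
  by rewrite /hilbert_series hilbert_functionE.
move=> [|d]; rewrite coefD coef1 coefCM coefX /=.
  by rewrite big_ord1 subnn HE coefB coef1 coefX subr0 mulr0 addr0 mulr1.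
rewrite 2!big_ord_recr big1/= => [|i _]; last first.
  rewrite coefB coef1 coefX.
  have : (1 < d.+1 - i)%N by rewrite ltn_subRL addn1 ltnS.
  by case: (d.+1 - i)%N => [|[|e]] //; rewrite subrr mulr0.
rewrite subnn subSnn !HE !coefB !coef1 !coefX /=.
rewrite subr0 mulrBr mulr0 !mulr1 add0r sub0r add0r.
by case: d => [|d] /=; rewrite ?mulr1 ?mulr0 addrC // subrr.
Qed.

Definition words_leq m : set word := [set w | (size w <= m)%N].

Definition normal_seq_leq m : seq word :=
  flatten [seq normal_seq d | d <- iota 0 m.+1].

Lemma size_normal_seq_leq m : size (normal_seq_leq m) = (n * m).+1.
Proof.
elim: m => [|m IHm]; first by rewrite muln0.
rewrite /normal_seq_leq -addn1 iotaD map_cat flatten_cat size_cat.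
rewrite -[flatten _]/(normal_seq_leq m) IHm /= cats0 size_map size_enum_ord.
by rewrite mulnS addSn addnC.
Qed.

Lemma normal_span_leq m :
  [set a | supported (words_leq m) (phi a)] `<=`
  lin_span [set` normal_seq_leq m] (fun w => pi (mono w)).
Proof.
move=> a am; rewrite -[a](quot_redK JE) (lin_span_image pi).
exists (phi a) => //; rewrite lin_span_mono => w wa.
have wN : normal_words I w.
  have := normal_quot_red x1_min a; rewrite /normal_span lin_span_mono.
  by apply.
apply/flattenP; exists (normal_seq (size w)).
  by apply/map_f; rewrite mem_iota add0n ltnS; exact: am.
have : normal_words_deg I (size w) w by [].
by rewrite normal_words_degE.
Qed.

Lemma quot_red1 : phi 1 = mono (FMonom [::]).
Proof.
by have [_ _ -> _ _] := quot_red_iso x1_min JE; exact: mono1.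
Qed.

Lemma supported_quot_redM i j (a b : A) :
  supported (words_leq i) (phi a) -> supported (words_leq j) (phi b) ->
  supported (words_leq (i + j)) (phi (a * b)).
Proof.
move=> ai bj; have [_ _ _ -> _] := quot_red_iso x1_min JE.
rewrite /normal_mul (NorE x1_min); apply: supported_red => [w|].
  by rewrite /words_leq /= size_collapse.
by apply: supportedM ai bj => w x wi xj; rewrite /words_leq /= size_cat leq_add.
Qed.

Lemma supported_quot_red_prod i (s : seq A) :
  (forall a, a \in s -> supported (words_leq i) (phi a)) ->
  supported (words_leq (i * size s)) (phi (\prod_(a <- s) a)).
Proof.
elim: s => [_|a s IHs si].
  by rewrite big_nil quot_red1; apply/supported_mono.
rewrite big_cons mulnS; apply: supported_quot_redM.
  by apply: si; rewrite mem_head.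
by apply: IHs => b bs; apply: si; rewrite inE bs orbT.
Qed.

Lemma words_leqW i j : (i <= j)%N ->
  supported (words_leq i) `<=` (supported (words_leq j) : set freealg).
Proof. by move=> ij u ui w /ui wi; exact: leq_trans wi ij. Qed.

Lemma supported_bound (s : seq A) :
  exists D, forall a, a \in s -> supported (words_leq D) (phi a).
Proof.
pose F a := (\max_(w <- msupp (phi a)) size w)%N.
exists (\max_(a <- s) F a)%N => a sa w wa.
apply: (@leq_trans (F a)); last exact: (@leq_bigmax_seq _ _ predT F).
exact: (@leq_bigmax_seq _ _ predT (fun x : word => size x)).
Qed.

(** If the normal forms of the elements of [s] have degree at most [D],
    products of at most [d] of them lie in degree at most [D * d], where there
    are only [n * (D * d) + 1] normal words. *)
Lemma dimension_power_span_leq (s : seq A) :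
  exists c, forall d, (0 < d)%N -> (dimension (power_span s d) <= c * d)%N.
Proof.
have [D sD] := supported_bound s; exists (n * D).+1 => d d0.
apply: (@leq_trans (size (normal_seq_leq (D * d)))); last first.
  by rewrite size_normal_seq_leq mulSn addnC mulnA -addn1 leq_add2l.
apply: dimension_leq; apply: subset_trans (@normal_span_leq _).
apply: lin_span_sub => [|w [ws wd]].
  have [S0 SD] := @subspace_supported k n (words_leq (D * d)).
  by split=> [|c a b Sa Sb] /=; rewrite ?linear0// linearP; apply: SD.
apply: (@words_leqW (D * size w)); first by rewrite leq_mul2l wd orbT.
by apply: supported_quot_red_prod => a /ws/sD.
Qed.

Lemma prod_nseq_gen a :
  \prod_(b <- nseq a (pi (gen k x1))) b = pi (mono (FMonom (nseq a x1))).
Proof.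
elim: a => [|a IHa]; first by rewrite big_nil -mono1 rmorph1.
by rewrite big_cons IHa /= -rmorphM/= -mono_cons.
Qed.

(** The powers of [x_1] are distinct normal words, hence free: this subspace
    witnesses that the growth is at least linear. *)
Lemma dimension_power_span_gen d :
  dimension (power_span [:: pi (gen k x1)] d) = d.+1.
Proof.
pose s := [seq FMonom (nseq a x1) | a <- iota 0 d.+1].
have -> : d.+1 = size s by rewrite size_map size_iota.
apply: (@dimension_basis _ _ _ s (fun w => pi (mono w))).
  rewrite map_inj_uniq ?iota_uniq// => a b [/(congr1 size)].
  by rewrite !size_nseq.
split.
  apply: (free_family_sub _ (normal_mono_free x1_min JE)) => w /mapP[a _ ->].
  rewrite normal_words_red_ker//=; apply/collapse_fixP.
  case: a => [|a]; [by left|right; exists a, x1].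
  by rewrite /pow_word -(addn1 a) nseqD cats1.
apply/seteqP; split; apply: lin_span_sub => [|w]; rewrite ?{1}/power_span.
- exact: subspace_lin_span.
- move=> /mapP[a + ->]; rewrite mem_iota add0n ltnS => /andP[_ ad].
  rewrite -prod_nseq_gen; apply: (mem_lin_span (fun w => \prod_(b <- w) b)).
  by split; [move=> b /nseqP[->]; rewrite mem_head|rewrite size_nseq].
- exact: subspace_lin_span.
- move=> [/= ws wd].
  have /all_pred1P-> : all (pred1 (pi (gen k x1))) w.
    by apply/allP => b /ws; rewrite inE.
  rewrite prod_nseq_gen; apply: (mem_lin_span (fun w => pi (mono w))).
  by apply: map_f; rewrite mem_iota.
Qed.

Lemma gk_dim_quot (R : realType) : gk_dim A R = 1%E.
Proof.
apply/eqP; rewrite eq_le; apply/andP; split.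
  apply: ge_ereal_sup => _ [s _ <-]; have [c sc] := dimension_power_span_leq s.
  exact: log_growth_le1 sc.
apply: le_trans (ereal_sup_ubound _); last by exists [:: pi (gen k x1)].
apply: (@log_growth_ge1 R (fun d => dimension (power_span _ d))) => d.
by rewrite dimension_power_span_gen.
Qed.

End Growth.

(** * The theorem *)

Theorem theorem3p4 (k : fieldType) (R : realType) (n : nat) (hn : (1 < n)%N)
    (f : {perm 'I_n}) :
  let x1 : 'I_n := Ordinal (ltnW hn) in
  let Re0 := yb_relations k (perm_solution f) in
  let Re := standard_relations k x1 in
  let I := ideal_gen Re0 in
  let A := yb_algebra k (perm_solution f) in
  let pi : freealg k n -> A := quot_proj (yb_ideal k (perm_solution f)) in
  let A_ : nat -> set A := quot_component (yb_ideal k (perm_solution f)) in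
  [/\
   [/\ Re0 = [set g | exists j p : 'I_n,
                g = gen k j * gen k p - gen k (f p) * gen k p],
       PBW I,
       ideal_gen Re = I,
       (Re #= `I_(n * (n - 1)))%card
     & (forall g, Re g -> homogeneous 2 g /\ is_binomial g) /\
       reduced_groebner_basis I Re],
   [/\ normal_words I = [set FMonom [::]] `|`
                         [set w | exists (a : nat) (m : 'I_n),
                                    w = pow_word x1 a m],
       basis_family (normal_words I) (fun w => pi (mono k w)) setT,
       graded_algebra A_ /\ gk_dim A R = 1%E,
       direct_sum (normal_span I) (normal_span_deg I) /\
       (exists phi : {linear A -> freealg k n},
          graded_iso_onto A_ (normal_span I) 1 (normal_mul I)
            (normal_span_deg I) phi)
     & forall d : nat, (1 <= d)%N ->
       [/\ basis_family (normal_words_deg I d) (fun w => pi (mono k w)) (A_ d),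
           normal_words_deg I d = range (pow_word x1 d.-1),
           pow_word x1 d.-1 x1 = FMonom (nseq d x1)
         & forall i j : 'I_n, (i < j)%N ->
             deglex (pow_word x1 d.-1 i) (pow_word x1 d.-1 j)]]
   & [/\ forall d : nat, (1 <= d)%N -> hilbert_function A_ d = n,
       forall d : nat, hilbert_series A_ d = (if d == 0%N then 1%N else n)%:Z
     & series_eq_frac (hilbert_series A_) (1 + (n%:Z - 1)%:P * 'X) (1 - 'X)]].
Proof.
move=> x1 Re0 Re I A pi A_.
have x1_min : forall i : 'I_n, (x1 <= i)%N by move=> i; exact: leq0n.
have IE : I = red_ker x1 by exact: ideal_yb.
have JE : ideal_set (yb_ideal k (perm_solution f)) = red_ker x1 by [].
split; rewrite ?IE.
- split; [by []|exact: PBW_red_ker|exact: ideal_standard|exact: card_standard|].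
  split; last exact: standard_reduced.
  move=> _ [j [p [jx1 ->]]].
  by split; [exact: homogeneous_rel|exact: binomial_rel].
- split.
  + rewrite normal_words_red_ker//; apply/seteqP; split=> w /=.
      by move=> /collapse_fixP.
    by move=> wE; apply/collapse_fixP.
  + exact: normal_basis.
  + by split; [exact: quot_graded JE|exact: gk_dim_quot x1_min JE R].
  + split; first exact: normal_direct_sum.
    by eexists; exact: quot_red_iso x1_min JE.
  + move=> [//|d] _; split; first exact: normal_deg_basis.
    * rewrite normal_words_degE//.
      apply/seteqP; split=> [w /mapP[m _ ->]|_ [m _ <-]] /=.
        by exists m.
      by apply: map_f; rewrite mem_enum.
    * by rewrite /pow_word /= -cats1 -[[:: x1]]/(nseq 1 x1) -nseqD addn1.
    * by move=> i j; exact: deglex_pow_word.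
- split; last exact: hilbert_series_frac x1_min JE.
  + by move=> [//|d] _; rewrite (hilbert_functionE x1_min JE).
  + by move=> d; rewrite /hilbert_series (hilbert_functionE x1_min JE).
Qed.
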